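(* Let $\mathbb{A}$ be a finite-dimensional Novikov algebra over $\mathbb{C}$, and let $g_0,g_1$ be symmetric bilinear forms on $\mathbb{A}$ satisfying $g(a\cdot b,c)=g(a,c\cdot b)$, let $f_0,f_1$ be skew-symmetric bilinear forms on $\mathbb{A}$ satisfying $f(a\cdot b,c)=f(a,c\cdot b)$ and $f(a\cdot b,c)+f(b\cdot c,a)+f(c\cdot a,b)=0$, and let $h_0,h_1$ be symmetric bilinear forms on $\mathbb{A}$ for which $h(a\cdot b,c)$ is totally symmetric in $a,b,c$ (for all $a,b,c\in\mathbb{A}$). Consider the compatible Poisson operators on $\mathscr{L}_\mathbb{A}^*$ $$\mathcal{P}_1\gamma=(R^*_\gamma u)_x+L^*_{\gamma_x}u+\tilde g_1\gamma_x+\tilde f_1\gamma_{xx}+\tilde h_1\gamma_{xxx},\qquad \mathcal{P}_0\gamma=\tilde g_0\gamma_x+\tilde f_0\gamma_{xx}+\tilde h_0\gamma_{xxx},$$ ($u\in\mathscr{L}^*_\mathbb{A}$, $\gamma\in\mathscr{L}_\mathbb{A}$), and the operator $\Lambda\gamma=\tilde g_0\gamma+\tilde f_0\gamma_x+\tilde h_0\gamma_{xx}$, assumed invertible (e.g. $g_0$ nondegenerate), so that $\mathcal{P}_0\gamma=\Lambda\gamma_x$. Fix a constant $c\in\mathbb{A}$ and put $v:=\Lambda^{-1}u\in\mathscr{L}_\mathbb{A}$. Define functionals $\mathcal{H}_i[v]=\int_{\mathbb{S}^1}H_i\,dx$ ($i=0,1,2$) with densities $$H_0=g_0(c,v),\qquad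 H_1=\tfrac12 g_0(v,v\cdot c)+\tfrac12 f_0(v_x,v\cdot c)+\tfrac12 h_0(v_{xx},v\cdot c),$$ $$H_2=\tfrac13 g_0(v,v\cdot(v\cdot c))+\tfrac13 f_0(v_x,v\cdot(v\cdot c))+\tfrac13 h_0(v\cdot c,v\cdot v_{xx})+\tfrac16 g_0(v\cdot c,v\cdot v)+\tfrac16 h_0(v_x\cdot c,v_x\cdot v)+\tfrac12 g_1(v,v\cdot c)+\tfrac12 f_1(v_x,v\cdot c)+\tfrac12 h_1(v_{xx},v\cdot c),$$ regarded as functionals of $u=\Lambda v$. Then $\delta_u\mathcal{H}_0=c$ (so $\mathcal{P}_0\delta_u\mathcal{H}_0=0$), and the bi-Hamiltonian chain $u_{t_1}=\mathcal{P}_1\delta_u\mathcal{H}_0=\mathcal{P}_0\delta_u\mathcal{H}_1$, $u_{t_2}=\mathcal{P}_1\delta_u\mathcal{H}_1=\mathcal{P}_0\delta_u\mathcal{H}_2$ holds. In terms of $v$, these first two flows are $$v_{t_1}=v_x\cdot c,$$ $$\tilde g_0(v_{t_2})+\tilde f_0(v_{xt_2})+\tilde h_0(v_{xxt_2})=\tilde g_0(v_x\cdot(v\cdot c))+\tilde g_0(v\cdot(v_x\cdot c))+L^*_{v\cdot c}\tilde g_0(v_x)+\tilde f_0(v_x\cdot(v_x\cdot c))+\tilde f_0(v_{xx}\cdot(v\cdot c))+2\tilde h_0((v_x\cdot c)\cdot v_{xx})+\tilde h_0((v\cdot c)\cdot v_{xxx})+\tilde g_1(v_x\cdot c)+\tilde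 f_1(v_{xx}\cdot c)+\tilde h_1(v_{xxx}\cdot c).$$
   Context: A Novikov algebra is a complex vector space $\mathbb{A}$ with a bilinear product $\cdot$ satisfying $(a\cdot b)\cdot c=(a\cdot c)\cdot b$ and $(a\cdot b)\cdot c-a\cdot(b\cdot c)=(b\cdot a)\cdot c-b\cdot(a\cdot c)$. Write $L_ab=R_ba=a\cdot b$; $(\,,\,):\mathbb{A}^*\times\mathbb{A}\to\mathbb{C}$ is the canonical pairing, and $L_a^*,R_b^*:\mathbb{A}^*\to\mathbb{A}^*$ are defined by $(L_a^*u,b)=(R_b^*u,a)=(u,a\cdot b)$. For a bilinear form $g$ on $\mathbb{A}$, $\tilde g:\mathbb{A}\to\mathbb{A}^*$ is defined by $g(a,b)=(\tilde g(a),b)$. $\mathscr{L}_\mathbb{A}$ is the space of smooth $\mathbb{A}$-valued functions of $x\in\mathbb{S}^1$ (a Lie algebra with bracket $[a,b]=a_x\cdot b-b_x\cdot a$), $\mathscr{L}^*_\mathbb{A}$ the space of smooth $\mathbb{A}^*$-valued functions on $\mathbb{S}^1$, with pairing $\langle u,a\rangle=\int_{\mathbb{S}^1}(u,a)\,dx$; all products, $L^*,R^*$ and tilde maps act pointwise in $x$, subscripts $x$ denote $x$-derivatives. For a functional $\mathcal{H}$ on $\mathscr{L}^*_\mathbb{A}$ of the form $\int_{\mathbb{S}^1}H(u,u_x,\dots)dx$, the variational derivative $\delta_u\mathcal{H}\in\mathscr{L}_\mathbb{A}$ is defined by $\langle w,\delta_u\mathcal{H}\rangle=\frac{d}{d\varepsilon}\mathcal{H}[u+\varepsilon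 w]|_{\varepsilon=0}$. $\Lambda$ is inverted as a (pseudo-)differential operator. *)

(* Defs.v *)
From HB Require Import structures.
From mathcomp Require Import all_boot all_order all_algebra.
From mathcomp Require Import complex.
From mathcomp Require Import all_classical all_reals all_analysis.

Set Implicit Arguments.
Unset Strict Implicit.
Unset Printing Implicit Defensive.

Import Order.TTheory GRing.Theory Num.Theory.
Local Open Scope ring_scope.
Local Open Scope classical_set_scope.

(* The finite-dimensional complex vector space A (with a chosen basis) is
   'rV[R[i]]_n; its dual A^* is also represented by 'rV[R[i]]_n, with the
   canonical pairing (u, a) = \sum_j u_j a_j. *)
Notation Vec R n := 'rV[(R : realType)[i]]_n.

Definition bilinear_map (R : realType) (n : nat)
  (m : Vec R n -> Vec R n -> Vec R n) : Prop :=
  forall (a : R[i]) (x y z : Vec R n),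
    m (a *: x + y) z = a *: m x z + m y z /\
    m z (a *: x + y) = a *: m z x + m z y.

Definition bilinear_form (R : realType) (n : nat)
  (g : Vec R n -> Vec R n -> R[i]) : Prop :=
  forall (a : R[i]) (x y z : Vec R n),
    g (a *: x + y) z = a * g x z + g y z /\
    g z (a *: x + y) = a * g z x + g z y.

Definition novikov (R : realType) (n : nat)
  (m : Vec R n -> Vec R n -> Vec R n) : Prop :=
  bilinear_map m /\
  (forall a b c, m (m a b) c = m (m a c) b) /\
  (forall a b c, m (m a b) c - m a (m b c) = m (m b a) c - m b (m a c)).

Definition pairing (R : realType) (n : nat) (u a : Vec R n) : R[i] :=
  \sum_(j < n) u 0 j * a 0 j.

Definition ebase (R : realType) (n : nat) (j : 'I_n) : Vec R n := delta_mx 0 j.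

(* tilde g : A -> A^*,  (tilde g a, b) = g (a, b) *)
Definition tld (R : realType) (n : nat) (g : Vec R n -> Vec R n -> R[i])
  (a : Vec R n) : Vec R n := \row_j g a (ebase R j).

(* (L^*_a u, b) = (u, a.b) *)
Definition Lstar (R : realType) (n : nat) (m : Vec R n -> Vec R n -> Vec R n)
  (a u : Vec R n) : Vec R n := \row_j pairing u (m a (ebase R j)).

(* (R^*_b u, a) = (u, a.b) *)
Definition Rstar (R : realType) (n : nat) (m : Vec R n -> Vec R n -> Vec R n)
  (b u : Vec R n) : Vec R n := \row_j pairing u (m (ebase R j) b).

Definition smoothR (R : realType) (f : R -> R) : Prop :=
  forall (k : nat) (x : R), derivable (iter k (@derive1 R R) f) x 1.

(* a smooth 1-periodic C^n-valued function, i.e. an element of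
   L_A (or of L^*_A) *)
Definition loop (R : realType) (n : nat) (v : R -> Vec R n) : Prop :=
  (forall j : 'I_n, smoothR (fun x => (@complex.Re R) (v x 0 j)) /\
                    smoothR (fun x => (@complex.Im R) (v x 0 j))) /\
  (forall x, v (x + 1) = v x).

Definition derC (R : realType) (phi : R -> R[i]) : R -> R[i] :=
  fun x => Complex (derive1 (fun y => (@complex.Re R) (phi y)) x)
                   (derive1 (fun y => (@complex.Im R) (phi y)) x).

Definition derivableC (R : realType) (phi : R -> R[i]) (x : R) : Prop :=
  derivable (fun y => (@complex.Re R) (phi y)) x 1 /\ derivable (fun y => (@complex.Im R) (phi y)) x 1.

Definition dx (R : realType) (n : nat) (v : R -> Vec R n) : R -> Vec R n :=
  fun x => \row_j derC (fun y => v y 0 j) x.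

Definition intS1 (R : realType) (phi : R -> R[i]) : R[i] :=
  Complex (Rintegral lebesgue_measure `[0, 1] (fun x => (@complex.Re R) (phi x)))
          (Rintegral lebesgue_measure `[0, 1] (fun x => (@complex.Im R) (phi x))).

Definition is_varder (R : realType) (n : nat)
  (F : (R -> Vec R n) -> R[i]) (u X : R -> Vec R n) : Prop :=
  loop X /\
  forall w : R -> Vec R n, loop w ->
    derivableC (fun e : R => F (fun x => u x + (Complex e 0) *: w x)) 0 /\
    derC (fun e : R => F (fun x => u x + (Complex e 0) *: w x)) 0
      = intS1 (fun x => pairing (w x) (X x)).

Definition P1op (R : realType) (n : nat) (m : Vec R n -> Vec R n -> Vec R n)
  (g1 f1 h1 : Vec R n -> Vec R n -> R[i]) (u gam : R -> Vec R n) : R -> Vec R n :=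
  fun x => dx (fun y => Rstar m (gam y) (u y)) x + Lstar m (dx gam x) (u x)
           + tld g1 (dx gam x) + tld f1 (dx (dx gam) x)
           + tld h1 (dx (dx (dx gam)) x).

Definition P0op (R : realType) (n : nat)
  (g0 f0 h0 : Vec R n -> Vec R n -> R[i]) (gam : R -> Vec R n) : R -> Vec R n :=
  fun x => tld g0 (dx gam x) + tld f0 (dx (dx gam) x)
           + tld h0 (dx (dx (dx gam)) x).

Definition Lam (R : realType) (n : nat)
  (g0 f0 h0 : Vec R n -> Vec R n -> R[i]) (gam : R -> Vec R n) : R -> Vec R n :=
  fun x => tld g0 (gam x) + tld f0 (dx gam x) + tld h0 (dx (dx gam) x).

Definition H0dens (R : realType) (n : nat) (g0 : Vec R n -> Vec R n -> R[i])
  (c : Vec R n) (v : R -> Vec R n) : R -> R[i] :=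
  fun x => g0 c (v x).

Definition H1dens (R : realType) (n : nat) (m : Vec R n -> Vec R n -> Vec R n)
  (g0 f0 h0 : Vec R n -> Vec R n -> R[i]) (c : Vec R n) (v : R -> Vec R n)
  : R -> R[i] :=
  fun x => 2^-1 * g0 (v x) (m (v x) c) + 2^-1 * f0 (dx v x) (m (v x) c)
           + 2^-1 * h0 (dx (dx v) x) (m (v x) c).

Definition H2dens (R : realType) (n : nat) (m : Vec R n -> Vec R n -> Vec R n)
  (g0 f0 h0 g1 f1 h1 : Vec R n -> Vec R n -> R[i]) (c : Vec R n)
  (v : R -> Vec R n) : R -> R[i] :=
  fun x =>
    3^-1 * g0 (v x) (m (v x) (m (v x) c))
  + 3^-1 * f0 (dx v x) (m (v x) (m (v x) c))
  + 3^-1 * h0 (m (v x) c) (m (v x) (dx (dx v) x))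
  + 6^-1 * g0 (m (v x) c) (m (v x) (v x))
  + 6^-1 * h0 (m (dx v x) c) (m (dx v x) (v x))
  + 2^-1 * g1 (v x) (m (v x) c)
  + 2^-1 * f1 (dx v x) (m (v x) c)
  + 2^-1 * h1 (dx (dx v) x) (m (v x) c).

(* a functional of v, regarded as a functional of u = Lambda v,
   i.e. F[u] = \int_{S^1} H(Lambda^{-1} u) dx *)
Definition functional_u (R : realType) (n : nat)
  (Linv : (R -> Vec R n) -> (R -> Vec R n))
  (H : (R -> Vec R n) -> R -> R[i]) : (R -> Vec R n) -> R[i] :=
  fun w => intS1 (H (Linv w)).

Definition flow2_rhs (R : realType) (n : nat) (m : Vec R n -> Vec R n -> Vec R n)
  (g0 f0 h0 g1 f1 h1 : Vec R n -> Vec R n -> R[i]) (c : Vec R n)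
  (v : R -> Vec R n) : R -> Vec R n :=
  fun x =>
    tld g0 (m (dx v x) (m (v x) c)) + tld g0 (m (v x) (m (dx v x) c))
  + Lstar m (m (v x) c) (tld g0 (dx v x))
  + tld f0 (m (dx v x) (m (dx v x) c)) + tld f0 (m (dx (dx v) x) (m (v x) c))
  + (tld h0 (m (m (dx v x) c) (dx (dx v) x))) *+ 2
  + tld h0 (m (m (v x) c) (dx (dx (dx v)) x))
  + tld g1 (m (dx v x) c) + tld f1 (m (dx (dx v) x) c)
  + tld h1 (m (dx (dx (dx v)) x) c).

Definition sym_form (R : realType) (n : nat) (g : Vec R n -> Vec R n -> R[i]) :=
  forall a b, g a b = g b a.
Definition skew_form (R : realType) (n : nat) (f : Vec R n -> Vec R n -> R[i]) :=
  forall a b, f a b = - f b a.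
Definition inv_form (R : realType) (n : nat) (m : Vec R n -> Vec R n -> Vec R n)
  (g : Vec R n -> Vec R n -> R[i]) :=
  forall a b c, g (m a b) c = g a (m c b).
Definition cyclic_form (R : realType) (n : nat) (m : Vec R n -> Vec R n -> Vec R n)
  (f : Vec R n -> Vec R n -> R[i]) :=
  forall a b c, f (m a b) c + f (m b c) a + f (m c a) b = 0.
Definition totsym_form (R : realType) (n : nat) (m : Vec R n -> Vec R n -> Vec R n)
  (h : Vec R n -> Vec R n -> R[i]) :=
  forall a b c,
    h (m a b) c = h (m a c) b /\ h (m a b) c = h (m b a) c /\
    h (m a b) c = h (m b c) a /\ h (m a b) c = h (m c a) b /\
    h (m a b) c = h (m c b) a.

(* Main.v *)
(* In terms of [v], [Lam] is formally self-adjoint on the circle, so the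
   gradient with respect to [u = Lam v] is [Lam^-1] of the gradient with respect
   to [v].  The quadratic part of each density has [v]-gradient [Lam (v.c)]; the
   gradient G of the cubic part of [H2] is found by one integration by parts,
   using that [h (x.c) (y.z)] is totally symmetric in x, y, z.  Hence the gradients
   in [u] are [v.c] and [Lam^-1 (G + Lam1 (v.c))], with [Lam1] the operator
   [Lam] built from (g1, f1, h1).  As [P0 X = (Lam X)_x], the chain reduces to a
   pointwise identity for [G_x], which follows from the Novikov axioms and the
   invariance of the forms. *)

Require Import Defs.
From HB Require Import structures.
From mathcomp Require Import all_boot all_order all_algebra.
From mathcomp Require Import complex ring.
From mathcomp Require Import all_classical all_reals all_analysis.

Set Implicit Arguments.
Unset Strict Implicit.
Unset Printing Implicit Defensive.

Import Order.TTheory GRing.Theory Num.Theory.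
Import numFieldNormedType.Exports.
Local Open Scope ring_scope.

Section SmoothFunctions.
Variable R : realType.
Implicit Types f g : R -> R.

Fixpoint diffn (k : nat) f : Prop :=
  (forall x, derivable f x 1) /\ if k is k'.+1 then diffn k' (derive1 f) else True.

Lemma diffn_derivable k f : diffn k f -> forall x, derivable f x 1.
Proof. by case: k => [|k] []. Qed.

Lemma diffnW k f : diffn k.+1 f -> diffn k f.
Proof.
elim: k f => [|k IH] f [df Dk]; first by split.
by split=> //; exact: IH.
Qed.

Lemma smoothRP f : smoothR f <-> forall k, diffn k f.
Proof.
split=> [sf k|df k x].
  elim: k f sf => [|k IH] f sf; split=> //; try exact: (sf 0).
  by apply: IH => j x; have := sf j.+1 x; rewrite iterSr.
elim: k f df => [|k IH] f df; first exact: (diffn_derivable (df 0)).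
by rewrite iterSr; apply: IH => j; have [] := df j.+1.
Qed.

Lemma derive1DE f g : (forall x, derivable f x 1) -> (forall x, derivable g x 1) ->
  derive1 (fun x => f x + g x) = (fun x => derive1 f x + derive1 g x).
Proof.
move=> df dg; apply/funext => x.
by rewrite !derive1E; apply: (@deriveD _ _ _ f g).
Qed.

Lemma derive1ME f g : (forall x, derivable f x 1) -> (forall x, derivable g x 1) ->
  derive1 (fun x => f x * g x) = (fun x => derive1 f x * g x + f x * derive1 g x).
Proof.
move=> df dg; apply/funext => x.
rewrite !derive1E; have := @deriveM _ _ f g x 1 (df x) (dg x).
by move=> e; rewrite [LHS]e addrC /GRing.scale /= mulrC.
Qed.

Lemma derive1NE f : (forall x, derivable f x 1) ->
  derive1 (fun x => - f x) = (fun x => - derive1 f x).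
Proof.
move=> df; apply/funext => x.
by rewrite !derive1E; apply: (@deriveN _ _ _ f).
Qed.

Lemma diffnD k f g : diffn k f -> diffn k g -> diffn k (fun x => f x + g x).
Proof.
elim: k f g => [|k IH] f g [df Df] [dg Dg].
  by split=> [x|]; [apply: (@derivableD _ _ _ f g)|].
split=> [x|]; first by apply: (@derivableD _ _ _ f g).
by rewrite derive1DE //; exact: IH.
Qed.

Lemma diffnN k f : diffn k f -> diffn k (fun x => - f x).
Proof.
elim: k f => [|k IH] f [df Df].
  by split=> [x|]; [apply: (@derivableN _ _ _ f)|].
split=> [x|]; first by apply: (@derivableN _ _ _ f).
by rewrite derive1NE //; exact: IH.
Qed.

Lemma diffnM k f g : diffn k f -> diffn k g -> diffn k (fun x => f x * g x).
Proof.
elim: k f g => [|k IH] f g Hf Hg.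
  case: Hf Hg => df _ [dg _].
  by split=> [x|]; [apply: (@derivableM _ _ f g)|].
have [df Df] := Hf; have [dg Dg] := Hg.
split=> [x|]; first by apply: (@derivableM _ _ f g).
by rewrite derive1ME //; apply: diffnD; apply: IH => //; exact: diffnW.
Qed.

Lemma smoothR_derivable f : smoothR f -> forall x, derivable f x 1.
Proof. by move=> sf; exact: (sf 0). Qed.

Lemma smoothR_derive1 f : smoothR f -> smoothR (derive1 f).
Proof. by move=> sf k x; rewrite -iterSr; exact: sf. Qed.

Lemma smoothR_cst (r : R) : smoothR (fun _ => r).
Proof.
apply/smoothRP => k; elim: k r => [|k IH] r; split=> //.
have -> : derive1 (fun _ : R => r) = (fun _ => 0); last exact: IH.
by apply/funext => x; rewrite derive1_cst.
Qed.

Lemma smoothRD f g : smoothR f -> smoothR g -> smoothR (fun x => f x + g x).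
Proof.
by move=> /smoothRP sf /smoothRP sg; apply/smoothRP => k; exact: diffnD.
Qed.

Lemma smoothRN f : smoothR f -> smoothR (fun x => - f x).
Proof. by move=> /smoothRP sf; apply/smoothRP => k; exact: diffnN. Qed.

Lemma smoothRM f g : smoothR f -> smoothR g -> smoothR (fun x => f x * g x).
Proof.
by move=> /smoothRP sf /smoothRP sg; apply/smoothRP => k; exact: diffnM.
Qed.

Lemma derive1_periodic f (t : R) : (forall x, f (x + t) = f x) ->
  forall x, derive1 f (x + t) = derive1 f x.
Proof.
move=> pf x; rewrite /derive1.
by under eq_fun do rewrite addrA !pf.
Qed.

Lemma smoothR_continuous f : smoothR f -> continuous f.
Proof.
move=> sf x; apply: differentiable_continuous.
by apply/derivable1_diffP; exact: smoothR_derivable.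
Qed.

Lemma smoothR_integrable f : smoothR f ->
  (@lebesgue_measure R).-integrable `[0, 1]%classic (EFin \o f).
Proof.
move=> sf; apply: continuous_compact_integrable; first exact: segment_compact.
by apply: continuous_subspaceT; exact: smoothR_continuous.
Qed.

Lemma Rintegral_derive1 f : smoothR f ->
  Rintegral lebesgue_measure `[0, 1]%classic (derive1 f) = f 1 - f 0.
Proof.
move=> sf; rewrite /Rintegral (@continuous_FTC2 _ _ f) //.
  apply: continuous_subspaceT; apply: smoothR_continuous.
  exact: smoothR_derive1.
split.
- by move=> x _; exact: smoothR_derivable.
- by apply: cvg_at_right_filter; exact: smoothR_continuous.
- by apply: cvg_at_left_filter; exact: smoothR_continuous.
Qed.

End SmoothFunctions.

Arguments smoothR_cst {R} r.

Section ComplexLoops.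
Variable R : realType.
Local Notation Re := (@complex.Re R).
Local Notation Im := (@complex.Im R).
Implicit Types phi psi : R -> R[i].

Definition loopC phi : Prop :=
  [/\ smoothR (fun x => Re (phi x)), smoothR (fun x => Im (phi x)) &
      forall x, phi (x + 1) = phi x].

Lemma ReD (z w : R[i]) : Re (z + w) = Re z + Re w.
Proof. by case: z w => [? ?] [? ?]. Qed.
Lemma ImD (z w : R[i]) : Im (z + w) = Im z + Im w.
Proof. by case: z w => [? ?] [? ?]. Qed.
Lemma ReM (z w : R[i]) : Re (z * w) = Re z * Re w + - (Im z * Im w).
Proof. by case: z w => [? ?] [? ?]. Qed.
Lemma ImM (z w : R[i]) : Im (z * w) = Re z * Im w + Im z * Re w.
Proof. by case: z w => [? ?] [? ?]. Qed.
Lemma ReIm_inj (z w : R[i]) : Re z = Re w -> Im z = Im w -> z = w.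
Proof. by case: z w => [? ?] [? ?] /= -> ->. Qed.

Lemma loopC_cst (z : R[i]) : loopC (fun _ => z).
Proof. by split=> //; exact: smoothR_cst. Qed.

Lemma loopCD phi psi : loopC phi -> loopC psi -> loopC (fun x => phi x + psi x).
Proof.
case=> a b pa [c d pb]; split=> [| |x]; last by rewrite pa pb.
- by under eq_fun do rewrite ReD; exact: smoothRD.
- by under eq_fun do rewrite ImD; exact: smoothRD.
Qed.

Lemma loopCM phi psi : loopC phi -> loopC psi -> loopC (fun x => phi x * psi x).
Proof.
case=> a b pa [c d pb]; split=> [| |x]; last by rewrite pa pb.
- under eq_fun do rewrite ReM.
  by apply: smoothRD; last apply: smoothRN; exact: smoothRM.
- under eq_fun do rewrite ImM.
  by apply: smoothRD; exact: smoothRM.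
Qed.

Lemma loopCZ (z : R[i]) phi : loopC phi -> loopC (fun x => z * phi x).
Proof. by move=> l; apply: loopCM => //; exact: loopC_cst. Qed.

Lemma loopC_sum (I : Type) (r : seq I) (F : I -> R -> R[i]) :
  (forall i, loopC (F i)) -> loopC (fun x => \sum_(i <- r) F i x).
Proof.
move=> lF; elim: r => [|i r IH].
  by under eq_fun do rewrite big_nil; exact: loopC_cst.
by under eq_fun do rewrite big_cons; exact: loopCD.
Qed.

Lemma loopC_derC phi : loopC phi -> loopC (derC phi).
Proof.
case=> a b p; split=> [| |x]; [exact: (smoothR_derive1 a)|exact: (smoothR_derive1 b)|].
by congr Complex; apply: derive1_periodic => y; rewrite p.
Qed.

Lemma derC_cst (z : R[i]) x : derC (fun _ => z) x = 0.
Proof. by rewrite /derC !derive1_cst. Qed.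

Lemma derCD phi psi x : loopC phi -> loopC psi ->
  derC (fun x => phi x + psi x) x = derC phi x + derC psi x.
Proof.
case=> a b _ [c d _]; apply: ReIm_inj; rewrite ?(ReD, ImD) /=.
  under eq_fun do rewrite ReD.
  by rewrite (derive1DE (smoothR_derivable a) (smoothR_derivable c)).
under eq_fun do rewrite ImD.
by rewrite (derive1DE (smoothR_derivable b) (smoothR_derivable d)).
Qed.

Lemma derCM phi psi x : loopC phi -> loopC psi ->
  derC (fun x => phi x * psi x) x = derC phi x * psi x + phi x * derC psi x.
Proof.
case=> a b _ [c d _].
have da := smoothR_derivable a; have db := smoothR_derivable b.
have dc := smoothR_derivable c; have dd := smoothR_derivable d.
apply: ReIm_inj; rewrite ?(ReD, ImD, ReM, ImM) /derC /=.
  under eq_fun do rewrite ReM.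
  rewrite derive1DE; last 2 first.
  - by apply: smoothR_derivable; exact: smoothRM.
  - by apply: smoothR_derivable; apply: smoothRN; exact: smoothRM.
  rewrite derive1NE; last by apply: smoothR_derivable; exact: smoothRM.
  by rewrite (derive1ME da dc) (derive1ME db dd); ring.
under eq_fun do rewrite ImM.
rewrite derive1DE; last 2 first.
- by apply: smoothR_derivable; exact: smoothRM.
- by apply: smoothR_derivable; exact: smoothRM.
by rewrite (derive1ME da dd) (derive1ME db dc); ring.
Qed.

Lemma derCZ (z : R[i]) phi x : loopC phi ->
  derC (fun x => z * phi x) x = z * derC phi x.
Proof.
move=> l; rewrite derCM //; last exact: loopC_cst.
by rewrite derC_cst mul0r add0r.
Qed.

Lemma derC_sum (I : Type) (r : seq I) (F : I -> R -> R[i]) x :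
  (forall i, loopC (F i)) ->
  derC (fun x => \sum_(i <- r) F i x) x = \sum_(i <- r) derC (F i) x.
Proof.
move=> lF; elim: r => [|i r IH].
  by under eq_fun do rewrite big_nil; rewrite derC_cst big_nil.
under eq_fun do rewrite big_cons.
by rewrite derCD ?IH ?big_cons //; exact: loopC_sum.
Qed.

Lemma intS1D phi psi : loopC phi -> loopC psi ->
  intS1 (fun x => phi x + psi x) = intS1 phi + intS1 psi.
Proof.
case=> a b _ [c d _]; apply: ReIm_inj; rewrite ?(ReD, ImD) /=.
  under eq_Rintegral do rewrite ReD.
  by rewrite (RintegralD _ (smoothR_integrable a) (smoothR_integrable c)).
under eq_Rintegral do rewrite ImD.
by rewrite (RintegralD _ (smoothR_integrable b) (smoothR_integrable d)).
Qed.

Lemma intS1Z (z : R[i]) phi : loopC phi ->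
  intS1 (fun x => z * phi x) = z * intS1 phi.
Proof.
case=> a b _.
have eZ (r : R) (f : R -> R) : smoothR f ->
    Rintegral lebesgue_measure `[0, 1]%classic (fun x => r * f x) =
    r * Rintegral lebesgue_measure `[0, 1]%classic f.
  by move=> sf; rewrite (RintegralZl _ _ (smoothR_integrable sf)).
have sZ (r : R) (f : R -> R) : smoothR f -> smoothR (fun x => r * f x).
  by move=> sf; exact (smoothRM (smoothR_cst r) sf).
apply: ReIm_inj; rewrite ?(ReM, ImM) /=.
  under eq_Rintegral do rewrite ReM -mulNr.
  rewrite (RintegralD _ (smoothR_integrable (sZ _ _ a))
    (smoothR_integrable (sZ _ _ b))) //.
  by rewrite (eZ _ _ a) (eZ _ _ b) mulNr.
under eq_Rintegral do rewrite ImM.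
rewrite (RintegralD _ (smoothR_integrable (sZ _ _ b))
  (smoothR_integrable (sZ _ _ a))) //.
by rewrite (eZ _ _ a) (eZ _ _ b).
Qed.

Lemma intS1_derC phi : loopC phi -> intS1 (derC phi) = 0.
Proof.
case=> a b p; rewrite /intS1 /= (Rintegral_derive1 a) (Rintegral_derive1 b).
by have := p 0; rewrite add0r => ->; rewrite !subrr.
Qed.

Lemma eq_intS1_derC phi psi kap : loopC psi -> loopC kap ->
  (forall x, phi x = psi x + derC kap x) -> intS1 phi = intS1 psi.
Proof.
move=> lpsi lkap e; have -> : phi = (fun x => psi x + derC kap x) by exact/funext.
by rewrite intS1D ?intS1_derC ?addr0 //; exact: loopC_derC.
Qed.

Lemma derC_cubic (F : R -> R[i]) (a b c d : R[i]) :
  (forall e : R, F e = a + Complex e 0 * (b + Complex e 0 * (c + Complex e 0 * d))) ->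
  derivableC F 0 /\ derC F 0 = b.
Proof.
move=> eF.
have key (f : R -> R) (p q r s : R) :
    (forall e, f e = p + e * (q + e * (r + e * s))) ->
    derivable f 0 1 /\ derive1 f 0 = q.
  move=> ef; pose G (e : R) : R := r + e * s; pose H (e : R) : R := q + e * G e.
  have sid : smoothR (@id R).
    apply/smoothRP => -[|k]; (split; first by move=> x; exact: derivable_id) => //=.
    have -> : derive1 (@id R) = (fun _ => 1).
      by apply/funext => x; rewrite derive1E derive_id.
    by have /smoothRP := smoothR_cst (1 : R); apply.
  have sG : smoothR G := smoothRD (smoothR_cst r) (smoothRM sid (smoothR_cst s)).
  have sH : smoothR H := smoothRD (smoothR_cst q) (smoothRM sid sG).
  have -> : f = (fun e => p + (id e * H e)) by exact/funext.
  have sI : smoothR (fun e => id e * H e) := smoothRM sid sH.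
  split; first exact: (smoothR_derivable (smoothRD (smoothR_cst p) sI)).
  rewrite (derive1DE (smoothR_derivable (smoothR_cst p)) (smoothR_derivable sI)).
  rewrite (derive1ME (smoothR_derivable sid) (smoothR_derivable sH)).
  by rewrite derive1_cst derive1E derive_id /H; ring.
have /key[dRe eRe] (e : R) : Re (F e) = Re a + e * (Re b + e * (Re c + e * Re d)).
  by rewrite eF ?(ReD, ReM, ImD, ImM) /=; ring.
have /key[dIm eIm] (e : R) : Im (F e) = Im a + e * (Im b + e * (Im c + e * Im d)).
  by rewrite eF ?(ReD, ReM, ImD, ImM) /=; ring.
by split=> //; apply: ReIm_inj.
Qed.

End ComplexLoops.

Section VectorLoops.
Variables (R : realType) (n : nat).
Local Notation V := (Vec R n).
Implicit Types (a b v p : R -> V) (g : V -> V -> R[i]).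

Lemma loopP v : loop v <-> forall j, loopC (fun x => v x 0 j).
Proof.
split=> [[sv pv] j|lv]; first by have [? ?] := sv j; split=> // x; rewrite pv.
split=> [j|x]; first by have [? ? _] := lv j.
by apply/rowP => j; have [_ _ ->] := lv j.
Qed.

Lemma loop_cst (z : V) : loop (fun _ : R => z).
Proof. by apply/loopP => j; exact: loopC_cst. Qed.

Lemma loopDZ v p (z : R[i]) : loop v -> loop p -> loop (fun x => v x + z *: p x).
Proof.
move=> /loopP lv /loopP lp; apply/loopP => j.
under eq_fun do rewrite !mxE.
by apply: loopCD => //; exact: loopCZ.
Qed.

Lemma loopD v p : loop v -> loop p -> loop (fun x => v x + p x).
Proof.
move=> lv lp; have -> : (fun x => v x + p x) = (fun x => v x + 1 *: p x).
  by apply/funext => x; rewrite scale1r.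
exact: loopDZ.
Qed.

Lemma loop_dx v : loop v -> loop (dx v).
Proof.
move=> /loopP lv; apply/loopP => j.
by under eq_fun do rewrite mxE; exact: loopC_derC.
Qed.

Lemma dxDZ v p (z : R[i]) : loop v -> loop p ->
  dx (fun x => v x + z *: p x) = (fun x => dx v x + z *: dx p x).
Proof.
move=> /loopP lv /loopP lp; apply/funext => x; apply/rowP => j; rewrite !mxE.
under eq_fun do rewrite !mxE.
by rewrite derCD ?derCZ //; exact: loopCZ.
Qed.

Lemma dxD v p : loop v -> loop p ->
  dx (fun x => v x + p x) = (fun x => dx v x + dx p x).
Proof.
move=> lv lp; have -> : (fun x => v x + p x) = (fun x => v x + 1 *: p x).
  by apply/funext => x; rewrite scale1r.
by rewrite dxDZ //; apply/funext => x; rewrite scale1r.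
Qed.

Lemma dx_cst (z : V) x : dx (fun _ : R => z) x = 0.
Proof. by apply/rowP => j; rewrite !mxE derC_cst. Qed.

Section Form.
Variables (g : V -> V -> R[i]) (Hg : bilinear_form g).

Lemma bformDl x y z : g (x + y) z = g x z + g y z.
Proof. by have [+ _] := Hg 1 x y z; rewrite scale1r mul1r. Qed.
Lemma bformDr x y z : g z (x + y) = g z x + g z y.
Proof. by have [_ +] := Hg 1 x y z; rewrite scale1r mul1r. Qed.
Lemma bform0l z : g 0 z = 0.
Proof. by apply: (addrI (g 0 z)); rewrite -bformDl !addr0. Qed.
Lemma bform0r z : g z 0 = 0.
Proof. by apply: (addrI (g z 0)); rewrite -bformDr !addr0. Qed.
Lemma bformZl (k : R[i]) x z : g (k *: x) z = k * g x z.
Proof. by have [+ _] := Hg k x 0 z; rewrite addr0 bform0l addr0. Qed.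
Lemma bformZr (k : R[i]) x z : g z (k *: x) = k * g z x.
Proof. by have [_ +] := Hg k x 0 z; rewrite addr0 bform0r addr0. Qed.
Lemma bform_suml I (r : seq I) (F : I -> V) z :
  g (\sum_(i <- r) F i) z = \sum_(i <- r) g (F i) z.
Proof.
by elim: r => [|i r IH]; rewrite ?big_nil ?bform0l // !big_cons bformDl IH.
Qed.
Lemma bform_sumr I (r : seq I) (F : I -> V) z :
  g z (\sum_(i <- r) F i) = \sum_(i <- r) g z (F i).
Proof.
by elim: r => [|i r IH]; rewrite ?big_nil ?bform0r // !big_cons bformDr IH.
Qed.

Lemma bform_basisr (a b : V) : g a b = \sum_(j < n) g a (ebase R j) * b 0 j.
Proof.
rewrite {1}(row_sum_delta b) bform_sumr.
by apply: eq_bigr => j _; rewrite bformZr mulrC.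
Qed.

Lemma bform_basis (a b : V) :
  g a b = \sum_(i < n) \sum_(j < n) g (ebase R i) (ebase R j) * (a 0 i * b 0 j).
Proof.
rewrite {1}(row_sum_delta a) bform_suml.
apply: eq_bigr => i _; rewrite bformZl bform_basisr mulr_sumr.
by apply: eq_bigr => j _; rewrite mulrCA.
Qed.

Lemma pairing_tld (a b : V) : pairing (tld g a) b = g a b.
Proof. by rewrite bform_basisr; apply: eq_bigr => j _; rewrite mxE. Qed.

Lemma loopC_form a b : loop a -> loop b -> loopC (fun x => g (a x) (b x)).
Proof.
move=> /loopP la /loopP lb; under eq_fun do rewrite bform_basis.
by do 2!(apply: loopC_sum => ?); apply: loopCZ; exact: loopCM.
Qed.

Lemma derC_form a b x : loop a -> loop b ->
  derC (fun x => g (a x) (b x)) x = g (dx a x) (b x) + g (a x) (dx b x).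
Proof.
move=> /loopP la /loopP lb.
have lM i j : loopC (fun x => g (ebase R i) (ebase R j) * (a x 0 i * b x 0 j)).
  by apply: loopCZ; exact: loopCM.
under eq_fun do rewrite bform_basis.
rewrite derC_sum; last by move=> i; exact: loopC_sum.
rewrite !bform_basis -big_split; apply: eq_bigr => i _.
rewrite derC_sum // -big_split; apply: eq_bigr => j _ /=.
by rewrite derCZ ?derCM ?mxE ?mulrDr //; exact: loopCM.
Qed.

Lemma loop_tld a : loop a -> loop (fun x => tld g (a x)).
Proof.
move=> la; apply/loopP => j; under eq_fun do rewrite mxE.
by apply: loopC_form => //; exact: loop_cst.
Qed.

Lemma dx_tld a : loop a -> dx (fun x => tld g (a x)) = (fun x => tld g (dx a x)).
Proof.
move=> la; apply/funext => x; apply/rowP => j; rewrite !mxE.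
under eq_fun do rewrite mxE.
by rewrite derC_form ?dx_cst ?bform0r ?addr0 //; exact: loop_cst.
Qed.

Lemma tldDZ x y (z : R[i]) : tld g (x + z *: y) = tld g x + z *: tld g y.
Proof. by apply/rowP => j; rewrite !mxE bformDl bformZl. Qed.

End Form.

Lemma bilinear_pairing : bilinear_form (@pairing R n).
Proof.
move=> k x y z; split; rewrite /pairing mulr_sumr -big_split /=.
  by apply: eq_bigr => j _; rewrite !mxE mulrDl mulrA.
by apply: eq_bigr => j _; rewrite !mxE mulrDr mulrCA.
Qed.

Lemma pairing_ebase (x : V) j : pairing x (ebase R j) = x 0 j.
Proof.
rewrite /pairing (bigD1 j) //= mxE !eqxx mulr1 big1 ?addr0 // => i ij.
by rewrite mxE (negPf ij) mulr0.
Qed.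

Section Product.
Variables (m : V -> V -> V) (Hm : bilinear_map m).

Lemma bilinear_coord j : bilinear_form (fun x y => m x y 0 j).
Proof. by move=> k x y z; have [-> ->] := Hm k x y z; rewrite !mxE. Qed.

Lemma loop_mul a b : loop a -> loop b -> loop (fun x => m (a x) (b x)).
Proof.
move=> la lb; apply/loopP => j; exact: (loopC_form (bilinear_coord j)).
Qed.

Lemma dx_mul a b x : loop a -> loop b ->
  dx (fun x => m (a x) (b x)) x = m (dx a x) (b x) + m (a x) (dx b x).
Proof.
move=> la lb; apply/rowP => j; rewrite !mxE.
exact: (derC_form (bilinear_coord j)).
Qed.

Lemma bmapDl x y z : m (x + y) z = m x z + m y z.
Proof. by apply/rowP => j; rewrite mxE (bformDl (bilinear_coord j)). Qed.
Lemma bmapDr x y z : m z (x + y) = m z x + m z y.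
Proof. by apply/rowP => j; rewrite mxE (bformDr (bilinear_coord j)). Qed.
Lemma bmapZl (k : R[i]) x z : m (k *: x) z = k *: m x z.
Proof. by apply/rowP => j; rewrite mxE (bformZl (bilinear_coord j)). Qed.
Lemma bmapZr (k : R[i]) x z : m z (k *: x) = k *: m z x.
Proof. by apply/rowP => j; rewrite mxE (bformZr (bilinear_coord j)). Qed.
Lemma bmap0l x : m 0 x = 0.
Proof. by apply/rowP => j; rewrite mxE (bform0l (bilinear_coord j)). Qed.
Lemma bmap0r x : m x 0 = 0.
Proof. by apply/rowP => j; rewrite mxE (bform0r (bilinear_coord j)). Qed.

Lemma dx_mul_cst a (z : V) : loop a ->
  dx (fun x => m (a x) z) = (fun x => m (dx a x) z).
Proof.
move=> la; apply/funext => x.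
by rewrite dx_mul // ?dx_cst ?bmap0r ?addr0 //; exact: loop_cst.
Qed.

End Product.

Section Lambda.
Variables g f h : V -> V -> R[i].
Hypotheses (Hg : bilinear_form g) (Hf : bilinear_form f) (Hh : bilinear_form h).

Lemma pairing_Lam a x z :
  pairing (Lam g f h a x) z = g (a x) z + f (dx a x) z + h (dx (dx a) x) z.
Proof. by rewrite /Lam !(bformDl bilinear_pairing) !pairing_tld. Qed.

Lemma loop_Lam a : loop a -> loop (Lam g f h a).
Proof.
move=> la; have la1 := loop_dx la; have la2 := loop_dx la1.
by apply: loopD; [apply: loopD|]; exact: loop_tld.
Qed.

Lemma P0opE a : P0op g f h a = Lam g f h (dx a).
Proof. by []. Qed.

Lemma dx_Lam a : loop a -> dx (Lam g f h a) = Lam g f h (dx a).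
Proof.
move=> la; have la1 := loop_dx la; have la2 := loop_dx la1.
have lg := loop_tld Hg la; have lf := loop_tld Hf la1; have lh := loop_tld Hh la2.
rewrite /Lam dxD //; last exact: loopD.
by rewrite (dxD lg lf) !dx_tld.
Qed.

Lemma Lam_DZ a b (z : R[i]) : loop a -> loop b ->
  Lam g f h (fun x => a x + z *: b x) =
  (fun x => Lam g f h a x + z *: Lam g f h b x).
Proof.
move=> la lb; have la1 := loop_dx la; have lb1 := loop_dx lb.
apply/funext => x; rewrite /Lam !dxDZ // !tldDZ // !scalerDr.
by rewrite [X in X + _ = _]addrACA [LHS]addrACA.
Qed.

Hypotheses (gs : sym_form g) (fs : skew_form f) (hs : sym_form h).

Lemma Lam_selfadjoint a b : loop a -> loop b ->
  intS1 (fun x => pairing (Lam g f h a x) (b x)) =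
  intS1 (fun x => pairing (Lam g f h b x) (a x)).
Proof.
move=> la lb; have la1 := loop_dx la; have lb1 := loop_dx lb.
have lfab := loopC_form Hf la lb; have lh1 := loopC_form Hh la1 lb.
have lh2 := loopCZ (-1) (loopC_form Hh la lb1).
apply: (@eq_intS1_derC _ _ _ (fun x => f (a x) (b x) + h (dx a x) (b x)
          + -1 * h (a x) (dx b x))).
- exact (loopC_form bilinear_pairing (loop_Lam lb) la).
- exact (loopCD (loopCD lfab lh1) lh2).
move=> x; rewrite (derCD _ (loopCD lfab lh1) lh2) (derCD _ lfab lh1).
rewrite (derCZ _ _ (loopC_form Hh la lb1)).
rewrite (derC_form Hf _ la lb) (derC_form Hh _ la1 lb) (derC_form Hh _ la lb1).
rewrite [LHS]pairing_Lam [X in _ = X + _]pairing_Lam.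
rewrite (gs (a x)) (fs (a x)) (hs (a x) (dx (dx b) x)).
by ring.
Qed.

Variable Linv : (R -> V) -> R -> V.
Hypotheses
  (HLinv1 : forall w, loop w -> loop (Linv w) /\ Lam g f h (Linv w) = w)
  (HLinv2 : forall v, loop v -> Linv (Lam g f h v) = v).

Lemma Linv_DZ u w (z : R[i]) : loop u -> loop w ->
  Linv (fun x => u x + z *: w x) = (fun x => Linv u x + z *: Linv w x).
Proof.
move=> lu lw; have [lv eu] := HLinv1 lu; have [lp ew] := HLinv1 lw.
by rewrite -{1}eu -{1}ew -Lam_DZ // HLinv2 //; exact: loopDZ.
Qed.

(* The densities are polynomials of degree at most 3 in [v], so the functional
   is a cubic polynomial in [e] along each line, and its derivative at 0 is the
   integral of the linear coefficient. *)
Lemma is_varder_cubic (H : (R -> V) -> R -> R[i]) (u X : R -> V) :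
  loop u -> loop X ->
  (forall p, loop p -> exists A0 A1 A2 A3 : R -> R[i],
    [/\ loopC A0, loopC A1, loopC A2 & loopC A3] /\
    (forall (e : R[i]) x, H (fun x => Linv u x + e *: p x) x
       = A0 x + e * (A1 x + e * (A2 x + e * A3 x))) /\
    intS1 A1 = intS1 (fun x => pairing (Lam g f h X x) (p x))) ->
  is_varder (functional_u Linv H) u X.
Proof.
move=> lu lX HA; split=> // w lw; have [lp ew] := HLinv1 lw.
have [A0 [A1 [A2 [A3 [[l0 l1 l2 l3] [eH eA1]]]]]] := HA _ lp.
have -> : intS1 (fun x => pairing (w x) (X x)) = intS1 A1.
  by rewrite eA1 -(Lam_selfadjoint lp lX) ew.
apply: (@derC_cubic _ _ (intS1 A0) _ (intS1 A2) (intS1 A3)) => e.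
have l23 := loopCD l2 (loopCZ (Complex e 0) l3).
have l123 := loopCD l1 (loopCZ (Complex e 0) l23).
rewrite /functional_u (Linv_DZ _ lu lw) (funext (eH _)).
rewrite (intS1D l0 (loopCZ _ l123)) (intS1Z _ l123).
by rewrite (intS1D l1 (loopCZ _ l23)) (intS1Z _ l23) (intS1D l2 (loopCZ _ l3)) (intS1Z _ l3).
Qed.

End Lambda.
End VectorLoops.

Section JetAlgebra.
Variables (R : realType) (n : nat).
Local Notation V := (Vec R n).
Variables (m : V -> V -> V) (g f h : V -> V -> R[i]).
Hypotheses (Hnov : novikov m).
Hypotheses (Hg : bilinear_form g) (Hf : bilinear_form f) (Hh : bilinear_form h).
Hypotheses (gs : sym_form g) (gi : inv_form m g).
Hypotheses (fs : skew_form f) (fi : inv_form m f) (fc : cyclic_form m f).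
Hypotheses (hs : sym_form h) (ht : totsym_form m h).
Variable c : V.

Let Hm : bilinear_map m := proj1 Hnov.

Lemma novikov_rcomm x y z : m (m x y) z = m (m x z) y.
Proof. by case: Hnov => _ []. Qed.

Lemma novikov_lsym x y z : m x (m y z) = m (m x y) z + -1 *: m (m y x) z + m y (m x z).
Proof.
case: Hnov => _ [_ /(_ x y z) e].
rewrite scaleN1r -[LHS](subKr (m (m x y) z)) e opprB addrA.
by rewrite [RHS]addrAC.
Qed.

Lemma totsymR x y z : h x (m y z) = h (m x z) y.
Proof. by rewrite hs; have [_ [_ [_ [_ ->]]]] := ht y z x. Qed.

Lemma totsym_swap x y z : h x (m y z) = h x (m z y).
Proof. by rewrite hs (hs x); have [_ [-> _]] := ht y z x. Qed.

Lemma totsym_mulc x y z : h (m x c) (m y z) = h (m y c) (m x z).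
Proof.
by rewrite totsymR novikov_rcomm -totsymR hs.
Qed.

Lemma inv_formR x y z : g x (m y z) = g (m x z) y.
Proof. by rewrite gi. Qed.

Lemma inv_mulc_swap x y z : g x (m (m y c) z) = g y (m (m x c) z).
Proof. by rewrite -gi gs gi novikov_rcomm. Qed.

Lemma skew_mulc x z : f x (m (m x c) z) = 0.
Proof.
have e : f x (m (m x c) z) = - f x (m (m x c) z).
  by rewrite -{1}fi fs fi novikov_rcomm.
have /eqP : f x (m (m x c) z) *+ 2 = 0 by rewrite mulr2n {1}e addNr.
by rewrite mulrn_eq0 /= => /eqP.
Qed.

Definition cubic_jet (a a1 b b1 d d2 : V) : R[i] :=
  3^-1 * g a (m b (m d c)) + 3^-1 * f a1 (m b (m d c))
  + 3^-1 * h (m a c) (m b d2) + 6^-1 * g (m a c) (m b d)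
  + 6^-1 * h (m a1 c) (m b1 d).

Definition quad_jet (a a1 a2 b : V) : R[i] :=
  2^-1 * g a (m b c) + 2^-1 * f a1 (m b c) + 2^-1 * h a2 (m b c).

Definition cubic_grad (v v1 v2 z : V) : R[i] :=
  g (m v (m v c)) z + 2^-1 * g (m v c) (m v z) + f (m v1 (m v c)) z
  + h (m (m v c) v2) z + 2^-1 * h (m (m v1 c) v1) z.

Lemma cubic_jetD (a a1 a2 p p1 p2 : V) (e : R[i]) :
  cubic_jet (a + e *: p) (a1 + e *: p1) (a + e *: p) (a1 + e *: p1)
            (a + e *: p) (a2 + e *: p2)
  = cubic_jet a a1 a a1 a a2
    + e * ((cubic_jet p p1 a a1 a a2 + cubic_jet a a1 p p1 a a2
            + cubic_jet a a1 a a1 p p2)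
    + e * ((cubic_jet p p1 p p1 a a2 + cubic_jet p p1 a a1 p p2
            + cubic_jet a a1 p p1 p p2)
    + e * cubic_jet p p1 p p1 p p2)).
Proof.
rewrite /cubic_jet !(bmapDl Hm, bmapDr Hm, bmapZl Hm, bmapZr Hm).
rewrite !(bformDl Hg, bformDr Hg, bformZl Hg, bformZr Hg).
rewrite !(bformDl Hf, bformDr Hf, bformZl Hf, bformZr Hf).
rewrite !(bformDl Hh, bformDr Hh, bformZl Hh, bformZr Hh).
by ring.
Qed.

Lemma quad_jetD (a a1 a2 b a' a1' a2' b' : V) (e : R[i]) :
  quad_jet (a + e *: a') (a1 + e *: a1') (a2 + e *: a2') (b + e *: b')
  = quad_jet a a1 a2 b + e * ((quad_jet a a1 a2 b' + quad_jet a' a1' a2' b)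
      + e * quad_jet a' a1' a2' b').
Proof.
rewrite /quad_jet !(bmapDl Hm) !(bmapZl Hm).
rewrite !(bformDl Hg) !(bformZl Hg) !(bformDr Hg) !(bformZr Hg).
rewrite !(bformDl Hf) !(bformZl Hf) !(bformDr Hf) !(bformZr Hf).
by rewrite !(bformDl Hh) !(bformZl Hh) !(bformDr Hh) !(bformZr Hh); ring.
Qed.

Lemma quad_jet_mulc a a1 a2 b :
  quad_jet a a1 a2 b
  = 2^-1 * (g (m a c) b + f (m a1 c) b + h (m a2 c) b).
Proof. by rewrite /quad_jet (gi a) (fi a1) totsymR !mulrDr. Qed.

(* The last six summands are the [x]-derivative of
   3^-1 f(p, v(vc)) + 3^-1 h(vc, v p_x) - 3^-1 h(vc, v_x p). *)
Lemma cubic_jet_variation (v v1 v2 p p1 p2 : V) :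
  cubic_jet p p1 v v1 v v2 + cubic_jet v v1 p p1 v v2 + cubic_jet v v1 v v1 p p2
  = cubic_grad v v1 v2 p
  + (3^-1 * (f p1 (m v (m v c)) + f p (m v1 (m v c) + m v (m v1 c)))
     + 3^-1 * (h (m v1 c) (m v p1) + h (m v c) (m v1 p1 + m v p2))
     + - 3^-1 * (h (m v1 c) (m v1 p) + h (m v c) (m v2 p + m v1 p1))).
Proof.
rewrite /cubic_jet /cubic_grad !(bformDr Hf) !(bformDr Hh).
rewrite !(novikov_lsym v p c) !(bformDr Hg) !(bformZr Hg) !(bformDr Hf) !(bformZr Hf).
have eg1 : g p (m v (m v c)) = g (m v (m v c)) p by rewrite gs.
have eg2 : g v (m p (m v c)) = g (m v (m v c)) p by rewrite gi.
have eg3 : g v (m (m v p) c) = g (m v c) (m v p) by rewrite gi.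
have eg4 : g v (m (m p v) c) = g (m (m v c) v) p by rewrite inv_formR inv_formR.
have eg5 : g (m p c) (m v v) = g (m (m v c) v) p by rewrite gi gs novikov_rcomm.
have eg6 : g (m v c) (m p v) = g (m (m v c) v) p by rewrite gi.
rewrite eg1 eg2 eg3 eg4 eg5 eg6.
have ef1 : f v1 (m p (m v c)) = f (m v1 (m v c)) p by rewrite fi.
have ef2 : f v1 (m (m v p) c) = f (m (m v1 c) v) p - f (m v (m v1 c)) p.
  have := fc v p (m v1 c); rewrite (fi p) (fs p) (fs (m v p)) => e.
  rewrite -[LHS]fi.
  by apply/eqP; rewrite -subr_eq0; apply/eqP; rewrite -[RHS]oppr0 -e; ring.
have ef3 : f v1 (m (m p v) c) = f (m (m v1 c) v) p by rewrite -fi -fi.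
have ef4 : f p (m v1 (m v c)) = - f (m v1 (m v c)) p by rewrite fs.
have ef5 : f p (m v (m v1 c)) = - f (m v (m v1 c)) p by rewrite fs.
rewrite ef1 ef2 ef3 ef4 ef5.
have eh1 : h (m p c) (m v v2) = h (m v c) (m v2 p).
  by rewrite totsym_mulc totsym_swap.
have eh2 : h (m v c) (m p v2) = h (m v c) (m v2 p) by rewrite totsym_swap.
have eh3 : h (m p1 c) (m v1 v) = h (m v c) (m v1 p1).
  by rewrite totsym_swap totsym_mulc totsym_swap.
have eh4 : h (m v1 c) (m p1 v) = h (m v c) (m v1 p1).
  by rewrite totsym_swap totsym_mulc.
have eh5 : h (m v1 c) (m v p1) = h (m v c) (m v1 p1) by rewrite totsym_mulc.
have eh6 : h (m (m v c) v2) p = h (m v c) (m v2 p).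
  by rewrite totsym_swap totsymR.
have eh7 : h (m (m v1 c) v1) p = h (m v1 c) (m v1 p).
  by rewrite totsym_swap totsymR.
rewrite eh1 eh2 eh3 eh4 eh5 eh6 eh7.
by field.
Qed.

Definition cubic_flow (v v1 v2 v3 z : V) : R[i] :=
  g (m v1 (m v c)) z + g (m v (m v1 c)) z + g v1 (m (m v c) z)
  + f (m v1 (m v1 c)) z + f (m v2 (m v c)) z
  + h (m (m v1 c) v2) z *+ 2 + h (m (m v c) v3) z.

Lemma cubic_grad_flow (v v1 v2 v3 z : V) :
  g (m v1 (m v c) + m v (m v1 c)) z
  + 2^-1 * (g (m v c) (m v1 z) + g (m v1 c) (m v z))
  + f (m v2 (m v c) + m v1 (m v1 c)) z
  + h (m (m v1 c) v2 + m (m v c) v3) z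
  + 2^-1 * h (m (m v2 c) v1 + m (m v1 c) v2) z
  = cubic_flow v v1 v2 v3 z.
Proof.
rewrite /cubic_flow !(bformDl Hg) !(bformDl Hf) !(bformDl Hh).
have eg1 : g (m v c) (m v1 z) = g v1 (m (m v c) z).
  by rewrite gi novikov_rcomm inv_mulc_swap.
have eg2 : g (m v1 c) (m v z) = g v1 (m (m v c) z) by rewrite gi novikov_rcomm.
have eh : h (m (m v2 c) v1) z = h (m (m v1 c) v2) z.
  by rewrite -totsymR totsym_swap totsym_mulc totsym_swap totsymR.
by rewrite eg1 eg2 eh; field.
Qed.

Lemma hamiltonian_flow v v1 v2 v3 z :
  (g v (m z (m v1 c)) + f v1 (m z (m v1 c)) + h v2 (m z (m v1 c)))
  + (g v1 (m z (m v c)) + f v2 (m z (m v c)) + h v3 (m z (m v c)))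
  + (g v (m (m v1 c) z) + f v1 (m (m v1 c) z) + h v2 (m (m v1 c) z))
  = cubic_flow v v1 v2 v3 z.
Proof.
rewrite /cubic_flow skew_mulc inv_mulc_swap.
rewrite -!gi -!fi (totsym_swap v2 z) (totsym_swap v3 z).
have eh y x : h y (m (m x c) z) = h (m (m x c) y) z.
  by rewrite hs; have [-> _] := ht (m x c) z y.
by rewrite !eh; ring.
Qed.

End JetAlgebra.

Section DualAction.
Variables (R : realType) (n : nat).
Local Notation V := (Vec R n).
Variables (m : V -> V -> V) (Hm : bilinear_map m).
Implicit Types a b u : R -> V.

Lemma pairing_Lstar (a u z : V) : pairing (Lstar m a u) z = pairing u (m a z).
Proof.
have B : bilinear_form (fun a z : V => pairing u (m a z)).
  move=> k x y t; have [-> ->] := Hm k x y t.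
  by rewrite !(bformDr (@bilinear_pairing R n)) !(bformZr (@bilinear_pairing R n)).
exact (pairing_tld B a z).
Qed.

Lemma pairing_Rstar (b u z : V) : pairing (Rstar m b u) z = pairing u (m z b).
Proof.
have B : bilinear_form (fun b z : V => pairing u (m z b)).
  move=> k x y t; have [-> ->] := Hm k x y t.
  by rewrite !(bformDr (@bilinear_pairing R n)) !(bformZr (@bilinear_pairing R n)).
exact (pairing_tld B b z).
Qed.

Lemma loop_Lstar a u : loop a -> loop u -> loop (fun x => Lstar m (a x) (u x)).
Proof.
move=> la lu; apply/loopP => j; under eq_fun do rewrite mxE.
exact (loopC_form (@bilinear_pairing R n) lu (loop_mul Hm la (loop_cst (ebase R j)))).
Qed.

Lemma dx_Lstar a u x : loop a -> loop u ->
  dx (fun x => Lstar m (a x) (u x)) x = Lstar m (dx a x) (u x) + Lstar m (a x) (dx u x).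
Proof.
move=> la lu; apply/rowP => j; rewrite !mxE; under eq_fun do rewrite mxE.
have lj := loop_cst (ebase R j : V).
rewrite (derC_form (@bilinear_pairing R n) _ lu (loop_mul Hm la lj)).
by rewrite (dx_mul Hm _ la lj) dx_cst (bmap0r Hm) addr0 addrC.
Qed.

Lemma dx_Rstar b u x : loop b -> loop u ->
  dx (fun x => Rstar m (b x) (u x)) x = Rstar m (dx b x) (u x) + Rstar m (b x) (dx u x).
Proof.
move=> lb lu; apply/rowP => j; rewrite !mxE; under eq_fun do rewrite mxE.
have lj := loop_cst (ebase R j : V).
rewrite (derC_form (@bilinear_pairing R n) _ lu (loop_mul Hm lj lb)).
by rewrite (dx_mul Hm _ lj lb) dx_cst (bmap0l Hm) add0r addrC.
Qed.

Lemma eq_pairing (u w : V) : (forall z, pairing u z = pairing w z) -> u = w.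
Proof. by move=> e; apply/rowP => j; rewrite -!pairing_ebase. Qed.

End DualAction.

(* Keeps unification from unfolding these down to sums over [R[i]] when it
   compares two distinct instances. *)
Local Opaque pairing tld dx Lam.

Section Densities.
Variables (R : realType) (n : nat).
Local Notation V := (Vec R n).
Variables (m : V -> V -> V) (g f h : V -> V -> R[i]).
Hypotheses (Hnov : novikov m).
Hypotheses (Hg : bilinear_form g) (Hf : bilinear_form f) (Hh : bilinear_form h).
Hypotheses (gs : sym_form g) (gi : inv_form m g).
Hypotheses (fs : skew_form f) (fi : inv_form m f) (fc : cyclic_form m f).
Hypotheses (hs : sym_form h) (ht : totsym_form m h).
Variable c : V.
Implicit Types a b d v p : R -> V.

Let Hm : bilinear_map m := proj1 Hnov.

Definition quad a b x := quad_jet m g f h c (a x) (dx a x) (dx (dx a) x) (b x).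

Definition cubic a b d x :=
  cubic_jet m g f h c (a x) (dx a x) (b x) (dx b x) (d x) (dx (dx d) x).

Definition cubic_gradient v x : V :=
  tld g (m (v x) (m (v x) c)) + 2^-1 *: Lstar m (v x) (tld g (m (v x) c))
  + tld f (m (dx v x) (m (v x) c)) + tld h (m (m (v x) c) (dx (dx v) x))
  + 2^-1 *: tld h (m (m (dx v x) c) (dx v x)).

Lemma loop_mulc a : loop a -> loop (fun x => m (a x) c).
Proof. by move=> la; exact (loop_mul Hm la (loop_cst c)). Qed.

Lemma loopC_quad a b : loop a -> loop b -> loopC (quad a b).
Proof.
move=> la lb; have la1 := loop_dx la; have la2 := loop_dx la1.
have lbc := loop_mulc lb.
exact (loopCD (loopCD (loopCZ _ (loopC_form Hg la lbc))
  (loopCZ _ (loopC_form Hf la1 lbc))) (loopCZ _ (loopC_form Hh la2 lbc))).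
Qed.

Lemma loopC_cubic a b d : loop a -> loop b -> loop d -> loopC (cubic a b d).
Proof.
move=> la lb ld; have la1 := loop_dx la; have lb1 := loop_dx lb.
have ld2 := loop_dx (loop_dx ld).
have lbdc := loop_mul Hm lb (loop_mulc ld).
exact (loopCD (loopCD (loopCD (loopCD
  (loopCZ _ (loopC_form Hg la lbdc)) (loopCZ _ (loopC_form Hf la1 lbdc)))
  (loopCZ _ (loopC_form Hh (loop_mulc la) (loop_mul Hm lb ld2))))
  (loopCZ _ (loopC_form Hg (loop_mulc la) (loop_mul Hm lb ld))))
  (loopCZ _ (loopC_form Hh (loop_mulc la1) (loop_mul Hm lb1 ld)))).
Qed.

Lemma quadDZ v p (e : R[i]) x : loop v -> loop p ->
  quad (fun x => v x + e *: p x) (fun x => v x + e *: p x) x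
  = quad v v x + e * ((quad v p x + quad p v x) + e * quad p p x).
Proof.
move=> lv lp; rewrite /quad (dxDZ e lv lp) (dxDZ e (loop_dx lv) (loop_dx lp)).
exact: quad_jetD.
Qed.

Lemma cubicDZ v p (e : R[i]) x : loop v -> loop p ->
  let w := fun x => v x + e *: p x in
  cubic w w w x
  = cubic v v v x + e * ((cubic p v v x + cubic v p v x + cubic v v p x)
      + e * ((cubic p p v x + cubic p v p x + cubic v p p x) + e * cubic p p p x)).
Proof.
move=> lv lp w; rewrite /cubic /w (dxDZ e lv lp) (dxDZ e (loop_dx lv) (loop_dx lp)).
exact: cubic_jetD.
Qed.

Lemma quad_variation v p : loop v -> loop p ->
  intS1 (fun x => quad v p x + quad p v x)
  = intS1 (fun x => pairing (Lam g f h (fun x => m (v x) c) x) (p x)).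
Proof.
move=> lv lp; have lvc := loop_mulc lv.
have lL := loop_Lam Hg Hf Hh.
have lP1 := loopC_form (@bilinear_pairing R n) (lL _ lvc) lp.
have lP2 := loopC_form (@bilinear_pairing R n) (lL _ lp) lvc.
have e x : quad v p x + quad p v x
    = 2^-1 * pairing (Lam g f h (fun x => m (v x) c) x) (p x)
      + 2^-1 * pairing (Lam g f h p x) (m (v x) c).
  congr (_ + _).
    rewrite /quad (quad_jet_mulc gi fi hs ht) (pairing_Lam Hg Hf Hh).
    by rewrite (dx_mul_cst Hm _ lv) (dx_mul_cst Hm _ (loop_dx lv)).
  by rewrite (pairing_Lam Hg Hf Hh) !mulrDr.
rewrite (funext e) (intS1D (loopCZ _ lP1) (loopCZ _ lP2)).
rewrite (intS1Z _ lP1) (intS1Z _ lP2).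
rewrite [X in _ + 2^-1 * X](Lam_selfadjoint Hg Hf Hh gs fs hs lp lvc).
by field.
Qed.

Lemma pairing_cubic_gradient v x z :
  pairing (cubic_gradient v x) z
  = cubic_grad m g f h c (v x) (dx v x) (dx (dx v) x) z.
Proof.
have Hp := @bilinear_pairing R n.
rewrite /cubic_gradient !(bformDl Hp) !(bformZl Hp) (pairing_Lstar Hm).
by rewrite !(pairing_tld Hg) !(pairing_tld Hf) !(pairing_tld Hh).
Qed.

Lemma loop_cubic_gradient v : loop v -> loop (cubic_gradient v).
Proof.
move=> lv; have lv1 := loop_dx lv; have lv2 := loop_dx lv1.
have lvc := loop_mulc lv; have lv1c := loop_mulc lv1.
exact (loopDZ _ (loopD (loopD (loopDZ _ (loop_tld Hg (loop_mul Hm lv lvc))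
  (loop_Lstar Hm lv (loop_tld Hg lvc))) (loop_tld Hf (loop_mul Hm lv1 lvc)))
  (loop_tld Hh (loop_mul Hm lvc lv2))) (loop_tld Hh (loop_mul Hm lv1c lv1))).
Qed.

Lemma cubic_variation v p : loop v -> loop p ->
  intS1 (fun x => cubic p v v x + cubic v p v x + cubic v v p x)
  = intS1 (fun x => pairing (cubic_gradient v x) (p x)).
Proof.
move=> lv lp; have lv1 := loop_dx lv; have lp1 := loop_dx lp.
have lvc := loop_mulc lv; have lv1c := loop_mulc lv1.
have lvvc := loop_mul Hm lv lvc.
have lvp1 := loop_mul Hm lv lp1; have lv1p := loop_mul Hm lv1 lp.
have l1 := loopC_form Hf lp lvvc.
have l2 := loopC_form Hh lvc lvp1.
have l3 := loopC_form Hh lvc lv1p.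
have lz1 := loopCZ 3^-1 l1; have lz2 := loopCZ 3^-1 l2.
have lz3 := loopCZ (- 3^-1) l3.
apply: (eq_intS1_derC (loopC_form (@bilinear_pairing R n) (loop_cubic_gradient lv) lp)
  (loopCD (loopCD lz1 lz2) lz3)) => x.
rewrite (derCD _ (loopCD lz1 lz2) lz3) (derCD _ lz1 lz2).
rewrite (derCZ _ _ l1) (derCZ _ _ l2) (derCZ _ _ l3).
rewrite (derC_form Hf _ lp lvvc) (derC_form Hh _ lvc lvp1) (derC_form Hh _ lvc lv1p).
rewrite (dx_mul Hm _ lv lvc) (dx_mul Hm _ lv lp1) (dx_mul Hm _ lv1 lp).
rewrite (dx_mul_cst Hm c lv) pairing_cubic_gradient.
exact: cubic_jet_variation.
Qed.

Lemma pairing_dx_cubic_gradient v x z : loop v ->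
  pairing (dx (cubic_gradient v) x) z
  = cubic_flow m g f h c (v x) (dx v x) (dx (dx v) x) (dx (dx (dx v)) x) z.
Proof.
move=> lv; have lv1 := loop_dx lv; have lv2 := loop_dx lv1.
have lvc := loop_mulc lv; have lv1c := loop_mulc lv1.
have lt1 := loop_mul Hm lv lvc; have lt2 := loop_mul Hm lv1 lvc.
have lt3 := loop_mul Hm lvc lv2; have lt4 := loop_mul Hm lv1c lv1.
have l1 := loop_tld Hg lt1; have lgvc := loop_tld Hg lvc.
have l2 := loop_Lstar Hm lv lgvc.
have l3 := loop_tld Hf lt2; have l4 := loop_tld Hh lt3; have l5 := loop_tld Hh lt4.
have l12 := loopDZ 2^-1 l1 l2; have l123 := loopD l12 l3.
have l1234 := loopD l123 l4.
rewrite /cubic_gradient (dxDZ 2^-1 l1234 l5) (dxD l123 l4) (dxD l12 l3) (dxDZ 2^-1 l1 l2).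
rewrite (dx_tld Hg lt1) (dx_tld Hf lt2) (dx_tld Hh lt3) (dx_tld Hh lt4).
rewrite (dx_Lstar Hm _ lv lgvc) (dx_tld Hg lvc).
rewrite (dx_mul Hm _ lv lvc) (dx_mul Hm _ lv1 lvc) (dx_mul Hm _ lvc lv2).
rewrite (dx_mul Hm _ lv1c lv1) (dx_mul_cst Hm c lv) (dx_mul_cst Hm c lv1).
have Hp := @bilinear_pairing R n.
rewrite !(bformDl Hp) !(bformZl Hp) !(bformDl Hp) !(pairing_Lstar Hm).
rewrite -(cubic_grad_flow Hnov Hg Hf Hh gs gi hs ht).
congr (_ + 2^-1 * (_ + _) + _ + _ + 2^-1 * _).
- exact (pairing_tld Hg _ _).
- exact (pairing_tld Hg _ _).
- exact (pairing_tld Hg _ _).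
- exact (pairing_tld Hf _ _).
- exact (pairing_tld Hh _ _).
- exact (pairing_tld Hh _ _).
Qed.

Variables (g1 f1 h1 : V -> V -> R[i]).
Hypotheses (Hg1 : bilinear_form g1) (Hf1 : bilinear_form f1) (Hh1 : bilinear_form h1).

Lemma pairing_P1op u gam x z : loop u -> loop gam ->
  pairing (P1op m g1 f1 h1 u gam x) z
  = pairing (u x) (m z (dx gam x)) + pairing (dx u x) (m z (gam x))
    + pairing (u x) (m (dx gam x) z)
    + g1 (dx gam x) z + f1 (dx (dx gam) x) z + h1 (dx (dx (dx gam)) x) z.
Proof.
move=> lu lgam; have Hp := @bilinear_pairing R n.
rewrite /P1op (dx_Rstar Hm _ lgam lu) !(bformDl Hp).
congr (_ + _ + _ + _ + _ + _); try exact: pairing_tld.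
- exact: pairing_Rstar.
- exact: pairing_Rstar.
- exact: pairing_Lstar.
Qed.

Lemma pairing_P1op_mulc v x z : loop v ->
  pairing (P1op m g1 f1 h1 (Lam g f h v) (fun x => m (v x) c) x) z
  = cubic_flow m g f h c (v x) (dx v x) (dx (dx v) x) (dx (dx (dx v)) x) z
    + g1 (m (dx v x) c) z + f1 (m (dx (dx v) x) c) z
    + h1 (m (dx (dx (dx v)) x) c) z.
Proof.
move=> lv; have lv1 := loop_dx lv; have lv2 := loop_dx lv1.
have lvc := loop_mulc lv; have lu := loop_Lam Hg Hf Hh lv.
rewrite (pairing_P1op _ _ lu lvc) (dx_Lam Hg Hf Hh lv).
rewrite (dx_mul_cst Hm c lv) (dx_mul_cst Hm c lv1) (dx_mul_cst Hm c lv2).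
congr (_ + _ + _ + _).
rewrite -(hamiltonian_flow Hnov gs gi fs fi hs ht).
congr (_ + _ + _).
- exact (pairing_Lam Hg Hf Hh v x _).
- exact (pairing_Lam Hg Hf Hh (dx v) x _).
- exact (pairing_Lam Hg Hf Hh v x _).
Qed.

Lemma pairing_flow2_rhs v x z :
  pairing (flow2_rhs m g f h g1 f1 h1 c v x) z
  = cubic_flow m g f h c (v x) (dx v x) (dx (dx v) x) (dx (dx (dx v)) x) z
    + g1 (m (dx v x) c) z + f1 (m (dx (dx v) x) c) z
    + h1 (m (dx (dx (dx v)) x) c) z.
Proof.
have Hp := @bilinear_pairing R n.
rewrite /flow2_rhs mulr2n !(bformDl Hp) (pairing_Lstar Hm).
rewrite /cubic_flow mulr2n.
congr (_ + _ + _ + _ + _ + (_ + _) + _ + _ + _ + _); exact: pairing_tld.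
Qed.

Lemma P1op_cst v x : loop v ->
  P1op m g1 f1 h1 (Lam g f h v) (fun=> c) x = Lam g f h (fun y => m (dx v y) c) x.
Proof.
move=> lv; have lv1 := loop_dx lv; have lv2 := loop_dx lv1.
have lu := loop_Lam Hg Hf Hh lv.
have dc : dx (fun=> c : V) = (fun _ : R => 0) by apply/funext => y; exact: dx_cst.
have d0 : dx (fun=> 0 : V) = (fun _ : R => 0) by apply/funext => y; exact: dx_cst.
have Hp := @bilinear_pairing R n.
apply: eq_pairing => z; rewrite [LHS](pairing_P1op _ _ lu (loop_cst c)).
rewrite dc !d0 (dx_Lam Hg Hf Hh lv).
transitivity (0 + pairing (Lam g f h (dx v) x) (m z c) + 0 + 0 + 0 + 0 : R[i]).
  congr (_ + pairing (Lam g f h (dx v) x) (m z c) + _ + _ + _ + _).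
  - by rewrite (bmap0r Hm) (bform0r Hp).
  - by rewrite (bmap0l Hm) (bform0r Hp).
  - exact: bform0l.
  - exact: bform0l.
  - exact: bform0l.
rewrite !addr0 add0r [LHS](pairing_Lam Hg Hf Hh) [RHS](pairing_Lam Hg Hf Hh).
rewrite (dx_mul_cst Hm c lv1) (dx_mul_cst Hm c lv2).
by rewrite (gi (dx v x)) (fi (dx (dx v) x)) (totsymR hs ht).
Qed.

End Densities.

Theorem theorem3p1 (R : realType) (n : nat)
  (m : Vec R n -> Vec R n -> Vec R n)
  (g0 g1 f0 f1 h0 h1 : Vec R n -> Vec R n -> R[i])
  (Hnov : novikov m)
  (Hg0b : bilinear_form g0) (Hg1b : bilinear_form g1)
  (Hf0b : bilinear_form f0) (Hf1b : bilinear_form f1)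
  (Hh0b : bilinear_form h0) (Hh1b : bilinear_form h1)
  (Hg0s : sym_form g0) (Hg1s : sym_form g1)
  (Hg0i : inv_form m g0) (Hg1i : inv_form m g1)
  (Hf0s : skew_form f0) (Hf1s : skew_form f1)
  (Hf0i : inv_form m f0) (Hf1i : inv_form m f1)
  (Hf0c : cyclic_form m f0) (Hf1c : cyclic_form m f1)
  (Hh0s : sym_form h0) (Hh1s : sym_form h1)
  (Hh0t : totsym_form m h0) (Hh1t : totsym_form m h1)
  (Linv : (R -> Vec R n) -> (R -> Vec R n))
  (HLinv1 : forall w, loop w -> loop (Linv w) /\ Lam g0 f0 h0 (Linv w) = w)
  (HLinv2 : forall v, loop v -> Linv (Lam g0 f0 h0 v) = v)
  (c : Vec R n) (u : R -> Vec R n) (Hu : loop u) :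
  let v := Linv u in
  let F0 := functional_u Linv (H0dens g0 c) in
  let F1 := functional_u Linv (H1dens m g0 f0 h0 c) in
  let F2 := functional_u Linv (H2dens m g0 f0 h0 g1 f1 h1 c) in
  let cst := fun _ : R => c in
  is_varder F0 u cst /\
  (forall x, P0op g0 f0 h0 cst x = 0) /\
  exists X1 X2 : R -> Vec R n,
    is_varder F1 u X1 /\ is_varder F2 u X2 /\
    (forall x, P1op m g1 f1 h1 u cst x = P0op g0 f0 h0 X1 x) /\
    (forall x, P1op m g1 f1 h1 u X1 x = P0op g0 f0 h0 X2 x) /\
    (forall x, P1op m g1 f1 h1 u cst x
               = Lam g0 f0 h0 (fun y => m (dx v y) c) x) /\
    (forall x, P1op m g1 f1 h1 u X1 x
               = flow2_rhs m g0 f0 h0 g1 f1 h1 c v x).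
Proof.
move=> v F0 F1 F2 cst.
have Hm : bilinear_map m := proj1 Hnov.
have Hp := @bilinear_pairing R n.
have [lv eu] : loop v /\ Lam g0 f0 h0 v = u := HLinv1 u Hu.
have lv1 := loop_dx lv; have lv2 := loop_dx lv1.
have dc : dx cst = (fun _ : R => 0) by apply/funext => y; exact: dx_cst.
have d0 : dx (fun=> 0 : Vec R n) = (fun _ : R => 0).
  by apply/funext => y; exact: dx_cst.
have varder := is_varder_cubic Hg0b Hf0b Hh0b Hg0s Hf0s Hh0s HLinv1 HLinv2.
have lC0 : loopC (fun _ : R => 0 : R[i]) := loopC_cst 0.
pose X1 : R -> Vec R n := fun x => m (v x) c.
have lX1 : loop X1 := loop_mulc Hnov c lv.
pose L1 := Lam g1 f1 h1 X1.
have lL1 : loop L1 := loop_Lam Hg1b Hf1b Hh1b lX1.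
pose G := cubic_gradient m g0 f0 h0 c v.
have lG : loop G := loop_cubic_gradient Hnov Hg0b Hf0b Hh0b c lv.
have lE := loopD lG lL1.
pose X2 := Linv (fun x => G x + L1 x).
have [lX2 eX2] : loop X2 /\ Lam g0 f0 h0 X2 = (fun x => G x + L1 x) := HLinv1 _ lE.
have flow1 x : P1op m g1 f1 h1 u cst x = Lam g0 f0 h0 (fun y => m (dx v y) c) x.
  by rewrite -eu; exact: P1op_cst.
split; [|split; [|exists X1, X2; split; [|split; [|split; [|split; [|split]]]]]].
- apply: (varder _ _ _ Hu (loop_cst c)) => p lp.
  exists (fun x => g0 c (v x)), (fun x => g0 c (p x)), (fun=> 0), (fun=> 0).
  split; [|split].
  + split=> //; [exact (loopC_form Hg0b (loop_cst c) lv)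
                |exact (loopC_form Hg0b (loop_cst c) lp)].
  + by move=> e x; rewrite /H0dens (bformDr Hg0b) (bformZr Hg0b); ring.
  + congr intS1; apply/funext => x.
    by rewrite (pairing_Lam Hg0b Hf0b Hh0b) dc d0 (bform0l Hf0b) (bform0l Hh0b) !addr0.
- move=> x; apply: eq_pairing => z.
  rewrite P0opE dc [LHS](pairing_Lam Hg0b Hf0b Hh0b) !d0.
  by rewrite (bform0l Hg0b) (bform0l Hf0b) (bform0l Hh0b) (bform0l Hp) !addr0.
- apply: (varder _ _ _ Hu lX1) => p lp.
  have lq := loopC_quad Hnov Hg0b Hf0b Hh0b c.
  exists (quad m g0 f0 h0 c v v),
    (fun x => quad m g0 f0 h0 c v p x + quad m g0 f0 h0 c p v x),
    (quad m g0 f0 h0 c p p), (fun=> 0).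
  split; [|split].
  + split=> //; [exact (lq _ _ lv lv)|exact (loopCD (lq _ _ lv lp) (lq _ _ lp lv))
                |exact (lq _ _ lp lp)].
  + move=> e x; apply: (etrans (quadDZ Hnov Hg0b Hf0b Hh0b c e x lv lp)).
    by congr (_ + e * (_ + e * _)); rewrite mulr0 addr0.
  + exact: quad_variation.
- apply: (varder _ _ _ Hu lX2) => p lp.
  have lq := loopC_quad Hnov Hg1b Hf1b Hh1b c.
  have lt := loopC_cubic Hnov Hg0b Hf0b Hh0b c.
  pose q := quad m g1 f1 h1 c; pose t := cubic m g0 f0 h0 c.
  have lA1 : loopC (fun x => t p v v x + t v p v x + t v v p x).
    exact (loopCD (loopCD (lt _ _ _ lp lv lv) (lt _ _ _ lv lp lv)) (lt _ _ _ lv lv lp)).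
  have lA2 : loopC (fun x => t p p v x + t p v p x + t v p p x).
    exact (loopCD (loopCD (lt _ _ _ lp lp lv) (lt _ _ _ lp lv lp)) (lt _ _ _ lv lp lp)).
  have lB1 : loopC (fun x => q v p x + q p v x).
    exact (loopCD (lq _ _ lv lp) (lq _ _ lp lv)).
  exists (fun x => t v v v x + q v v x),
    (fun x => (t p v v x + t v p v x + t v v p x) + (q v p x + q p v x)),
    (fun x => (t p p v x + t p v p x + t v p p x) + q p p x), (t p p p).
  split; [|split].
  + split; [exact (loopCD (lt _ _ _ lv lv lv) (lq _ _ lv lv))|exact (loopCD lA1 lB1)
           |exact (loopCD lA2 (lq _ _ lp lp))|exact (lt _ _ _ lp lp lp)].
  + move=> e x.
    pose w := fun x => v x + e *: p x.
    have -> : H2dens m g0 f0 h0 g1 f1 h1 c w x = t w w w x + q w w x.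
      by rewrite /H2dens /t /q /cubic /quad /cubic_jet /quad_jet !addrA.
    have addP (a a1 a2 a3 b b1 b2 : R[i]) :
        a + e * (a1 + e * (a2 + e * a3)) + (b + e * (b1 + e * b2))
        = a + b + e * (a1 + b1 + e * (a2 + b2 + e * a3)) by ring.
    rewrite -addP; congr (_ + _).
      exact (cubicDZ Hnov Hg0b Hf0b Hh0b c e x lv lp).
    exact (quadDZ Hnov Hg1b Hf1b Hh1b c e x lv lp).
  + rewrite (intS1D lA1 lB1) eX2.
    have -> : (fun x => pairing (G x + L1 x) (p x))
        = (fun x => pairing (G x) (p x) + pairing (L1 x) (p x)).
      by apply/funext => x; rewrite (bformDl Hp).
    rewrite (intS1D (loopC_form Hp lG lp) (loopC_form Hp lL1 lp)).
    by congr (_ + _); [exact: cubic_variation|exact: quad_variation].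
- by move=> x; rewrite flow1 P0opE /X1 (dx_mul_cst Hm c lv).
- move=> x; rewrite P0opE -(dx_Lam Hg0b Hf0b Hh0b lX2) eX2 (dxD lG lL1).
  rewrite (dx_Lam Hg1b Hf1b Hh1b lX1) -eu; apply: eq_pairing => z.
  rewrite [LHS](pairing_P1op_mulc Hnov Hg0b Hf0b Hh0b) //.
  rewrite (bformDl Hp) (pairing_dx_cubic_gradient Hnov) //.
  rewrite [X in _ = _ + X](pairing_Lam Hg1b Hf1b Hh1b) /X1 (dx_mul_cst Hm c lv).
  by rewrite (dx_mul_cst Hm c lv1) (dx_mul_cst Hm c lv2) !addrA.
- exact: flow1.
- move=> x; rewrite -eu; apply: eq_pairing => z.
  rewrite [LHS](pairing_P1op_mulc Hnov Hg0b Hf0b Hh0b) //.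
  by rewrite [RHS](pairing_flow2_rhs Hnov).
Qed.
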